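(* Let $\beta\in B$ and $a\in\mathbb R^d$. Suppose that the duality gap for $a$ is zero, i.e. $J_\beta(a)=K_\beta^*(a)$, and that the dual value $K_\beta^*(a)$ is attained (it is finite and a dual solution for $a$ exists). Then the generalized primal solution $\hat g_a$ for $a$ exists if and only if $\Theta_\beta\ne\emptyset$, in which case $\hat g_a=g_a^*$ ($\mu$-a.e.), where $g_a^*$ is the effective dual solution for $a$.
   Context: Setting. $(Z,\mathcal Z)$ is a measurable space with a $\sigma$-finite measure $\mu$, and $\varphi\colon Z\to\mathbb R^d$ is $\mathcal Z$-measurable (the moment mapping). $\Gamma$ is the class of functions $\gamma\colon\mathbb R\to(-\infty,+\infty]$ that are finite and strictly convex on $(0,+\infty)$, equal to $+\infty$ for $t<0$, and satisfy $\gamma(0)=\lim_{t\downarrow0}\gamma(t)$. $B$ is the class of functions $\beta\colon Z\times\mathbb R\to(-\infty,+\infty]$ such that $\beta(\cdot,t)$ is $\mathcal Z$-measurable for each $t$ and $\beta(z,\cdot)\in\Gamma$ for each $z$. Convention: an integral whose positive and negative parts are both infinite equals $+\infty$. $\mathcal G$ is the linear space of $\mathcal Z$-measurable $g\colon Z\to\mathbb R$ with $\varphi g$ $\mu$-integrable; $\mathcal G_a=\{g\in\mathcal G\colon\int_Z\varphi g\,d\mu=a\}$; the superscript $+$ denotes the subset of nonnegative functions. $H_\beta(g)=\int_Z\beta(z,g(z))\,\mu(dz)$, $J_\beta(a)=\inf_{g\in\mathcal G_a^+}H_\beta(g)$ ($\inf\emptyset=+\infty$). $\beta^*(z,r)=\sup_t[rt-\beta(z,t)]$,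 $(\beta^* )'(z,\cdot)$ is its derivative in $r$; $K_\beta(\vartheta)=\int_Z\beta^*(z,\langle\vartheta,\varphi(z)\rangle)\,\mu(dz)$; the dual value for $a$ is $K_\beta^*(a)=\sup_{\vartheta\in\mathbb R^d}[\langle\vartheta,a\rangle-K_\beta(\vartheta)]$; if it is finite, its maximizers are the dual solutions for $a$. Generalized primal solution. A minimizing sequence for $a$ (with $J_\beta(a)$ finite) is a sequence $g_n\in\mathcal G_a^+$ with $H_\beta(g_n)\to J_\beta(a)$. If all minimizing sequences converge locally in measure to a common measurable function, that limit is the generalized primal solution $\hat g_a$; convergence $g_n\to\hat g_a$ locally in measure means $\mu(Y\cap\{|g_n-\hat g_a|>\varepsilon\})\to0$ for every $Y\in\mathcal Z$ with $\mu(Y)<\infty$ and every $\varepsilon>0$. $\Theta_\beta$ is the set of $\vartheta\in\mathbb R^d$ with $K_\beta(\vartheta)<+\infty$ such that for $\mu$-a.a. $z$ the function $r\mapsto\beta^*(z,r)$ is finite in a neighborhood of $\langle\vartheta,\varphi(z)\rangle$. The condition $\Theta_\beta\ne\emptyset$ is the dual constraint qualification (DCQ). $f_\vartheta(z)=(\beta^* )'(z,\langle\vartheta,\varphi(z)\rangle)$ if $\beta^*(z,\cdot)$ is differentiable at $\langle\vartheta,\varphi(z)\rangle$, and $f_\vartheta(z)=0$ otherwise. Under the DCQ, all dual solutions $\vartheta$ for $a$ belong to $\Theta_\beta$ and give $\mu$-a.e. the same function $f_\vartheta$; this function is the effective dual solution $g_a^*$ for $a$. *)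

(* Defs.v *)
From HB Require Import structures.
From mathcomp Require Import all_boot all_order all_algebra.
From mathcomp Require Import all_classical all_reals all_analysis.
From mathcomp Require Import measurable_realfun.

Set Implicit Arguments.
Unset Strict Implicit.
Unset Printing Implicit Defensive.

Import Order.TTheory GRing.Theory Num.Theory.
Import numFieldNormedType.Exports.

Local Open Scope classical_set_scope.
Local Open Scope ring_scope.
Local Open Scope ereal_scope.

Section extended_real_functions.
Context {R : realType}.
Implicit Types (gamma h : R -> \bar R) (x y p r t : R).

Definition strictly_convex_pos gamma : Prop :=
  forall x y p, (0 < x)%R -> (0 < y)%R -> x != y -> (0 < p < 1)%R ->
    gamma (p * x + (1 - p) * y)%R < p%:E * gamma x + (1 - p)%:E * gamma y.

Definition Gamma gamma : Prop :=
  [/\ forall t, -oo < gamma t,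
      forall t, (0 < t)%R -> gamma t \is a fin_num,
      strictly_convex_pos gamma,
      forall t, (t < 0)%R -> gamma t = +oo &
      gamma t @[t --> 0^'+] --> gamma 0%R].

Definition conjugate h r : \bar R :=
  ereal_sup [set (r * t)%:E - h t | t in [set: R]].

(* Differentiability of an extended-real function: it is finite near r, so that
   [fine \o h] carries no junk value in the difference quotients at r. *)
Definition differentiable_at h r : Prop :=
  (\forall s \near r, h s \is a fin_num) /\ derivable (fine \o h) r 1.

End extended_real_functions.

Definition inner {R : realType} {d : nat} (u v : 'rV[R]_d) : R :=
  (\sum_(i < d) u ord0 i * v ord0 i)%R.

Section moment_problem.
Context {disp : measure_display} {Z : measurableType disp} {R : realType}
        {d : nat}.
Variable mu : {measure set Z -> \bar R}.
Variable phi : Z -> 'rV[R]_d.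
Variable beta : Z -> R -> \bar R.
Implicit Types (g : Z -> R) (a theta : 'rV[R]_d).

(* Borel measurability into R^d, expressed coordinatewise. *)
Definition measurable_moment_map : Prop :=
  forall i : 'I_d, measurable_fun [set: Z] (fun z => phi z ord0 i).

Definition integrand_class : Prop :=
  (forall t : R, measurable_fun [set: Z] (beta ^~ t)) /\
  (forall z, Gamma (beta z)).

(* In \bar R, the library has +oo - +oo = -oo; the integral of a function with
   infinite positive and negative parts has to be +oo here. *)
Definition eintegral (f : Z -> \bar R) : \bar R :=
  if \int[mu]_z f^\+ z == +oo then +oo else \int[mu]_z f z.

Definition calG : set (Z -> R) :=
  [set g | measurable_fun [set: Z] g /\
    forall i : 'I_d,
      mu.-integrable [set: Z] (fun z => (phi z ord0 i * g z)%:E)].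

Definition calG_at a : set (Z -> R) :=
  [set g | calG g /\
    forall i : 'I_d, \int[mu]_z (phi z ord0 i * g z)%:E = (a ord0 i)%:E].

Definition calG_at_nneg a : set (Z -> R) :=
  [set g | calG_at a g /\ forall z, (0 <= g z)%R].

Definition H_fun g : \bar R := eintegral (fun z => beta z (g z)).

Definition J_fun a : \bar R := ereal_inf [set H_fun g | g in calG_at_nneg a].

Definition K_fun theta : \bar R :=
  eintegral (fun z => conjugate (beta z) (inner theta (phi z))).

Definition dual_value a : \bar R :=
  ereal_sup [set (inner theta a)%:E - K_fun theta | theta in [set: 'rV[R]_d]].

Definition dual_solution a theta : Prop :=
  dual_value a \is a fin_num /\
  (inner theta a)%:E - K_fun theta = dual_value a.

Definition minimizing_sequence a (gs : nat -> Z -> R) : Prop :=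
  [/\ J_fun a \is a fin_num,
      forall n, calG_at_nneg a (gs n) &
      H_fun (gs n) @[n --> \oo] --> J_fun a].

Definition cvg_locally_in_measure (gs : nat -> Z -> R) g : Prop :=
  forall (Y : set Z) (e : R), measurable Y -> mu Y < +oo -> (0 < e)%R ->
    mu (Y `&` [set z | (e < `|gs n z - g z|)%R]) @[n --> \oo] --> 0.

(* The limit is determined only up to mu-null sets, hence a predicate on its
   representatives. *)
Definition generalized_primal_solution a g : Prop :=
  [/\ J_fun a \is a fin_num,
      measurable_fun [set: Z] g &
      forall gs, minimizing_sequence a gs -> cvg_locally_in_measure gs g].

Definition Theta : set 'rV[R]_d :=
  [set theta | K_fun theta < +oo /\
    {ae mu, forall z, \forall r \near inner theta (phi z),
      conjugate (beta z) r \is a fin_num}].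

Definition f_of theta : Z -> R := fun z =>
  if `[< differentiable_at (conjugate (beta z)) (inner theta (phi z)) >]
  then derive1 (fine \o conjugate (beta z)) (inner theta (phi z)) else 0%R.

(* The common mu-a.e. class of the functions [f_of theta], theta ranging over
   the dual solutions for a, all of them in Theta. *)
Definition effective_dual_solution a g : Prop :=
  (exists theta, dual_solution a theta) /\
  (forall theta, dual_solution a theta ->
     Theta theta /\ g = f_of theta %[ae mu]).

End moment_problem.

(* Main.v *)
Require Import Defs.
From HB Require Import structures.
From mathcomp Require Import all_boot all_order all_algebra.
From mathcomp Require Import all_classical all_reals all_analysis.
From mathcomp Require Import measurable_realfun.
From mathcomp Require Import ring lra.

Set Implicit Arguments.
Unset Strict Implicit.
Unset Printing Implicit Defensive.

Import Order.TTheory GRing.Theory Num.Theory.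
Import numFieldNormedType.Exports.

Local Open Scope classical_set_scope.
Local Open Scope ring_scope.

(* Write beta' z for the conjugate of beta z. Let theta be a dual solution,
   r z = <theta, phi z>, and let
   F z t = beta z t + beta' z (r z) - r z * t >= 0 be the Fenchel-Young gap.
   Since there is no duality gap, the integral of F z (g z) equals H g - J for
   every feasible g, so it tends to 0 along minimizing sequences.

   If beta' z is finite near r z, then F z is a convex function vanishing only
   at the derivative of beta' z at r z and bounded away from 0 off each
   neighbourhood of this point; hence minimizing sequences converge to f_theta wherever this holds.
   If r z is the right endpoint of the domain of beta' z, then F z is positive
   and nonincreasing; minimizing sequences escape to +oo on the set of such z,
   and a finite limit forces this set to be null, i.e. theta is in Theta.

   If eta is in Theta then so is theta: at the endpoints beta' z has slope +oo,
   so a non-null set of endpoints would make the derivative of K at theta in the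
   direction eta - theta equal to -oo, against the optimality of theta. *)

(** * Functions of class Gamma and their conjugates *)

Section Gamma_theory.
Context {R : realType}.
Implicit Types (F gamma : R -> \bar R) (a b c e k m r s t x y z : R).

Lemma cvg_at_right_seq (u : nat -> R) x :
  (forall n, x < u n) -> u n @[n --> \oo] --> x -> u n @[n --> \oo] --> x^'+.
Proof.
move=> xu ux A xA.
have : \forall n \near \oo, x < u n -> A (u n) by exact: (ux (fun y => x < y -> A y) xA).
by apply: filterS => n /(_ (xu n)).
Qed.

Lemma Gamma_EFin F t : Gamma F -> 0 < t -> F t = (fine (F t))%:E.
Proof. by case=> _ Ffin _ _ _ t0; rewrite fineK// Ffin. Qed.

Lemma Gamma_fin_ge0 F t : Gamma F -> (F t < +oo)%E -> 0 <= t.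
Proof. by case=> _ _ _ Fneg _; case: (ltP t 0) => // /Fneg ->; rewrite ltxx. Qed.

Lemma Gamma_gtNy F t : Gamma F -> (-oo < F t)%E.
Proof. by case. Qed.

(** Strict convexity with the weights solved for the middle point and denominators cleared, a form
    suited to linear arithmetic. *)
Lemma Gamma_strict3 F x y z : Gamma F -> 0 < x -> x < y -> y < z ->
  (z - x) * fine (F y) < (z - y) * fine (F x) + (y - x) * fine (F z).
Proof.
move=> GF x0 xy yz; have [_ _ Fconv _ _] := GF.
have zx : 0 < z - x by lra.
have := @Fconv x z ((z - y) / (z - x)) x0 _ _ _.
have -> : (z - y) / (z - x) * x + (1 - (z - y) / (z - x)) * z = y.
  by field; rewrite gt_eqF.
have -> : 1 - (z - y) / (z - x) = (y - x) / (z - x).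
  by field; rewrite gt_eqF.
have y0 : 0 < y by exact: lt_trans xy.
have z0 : 0 < z by exact: lt_trans yz.
rewrite (Gamma_EFin GF x0) (Gamma_EFin GF y0) (Gamma_EFin GF z0).
rewrite -!EFinM -EFinD lte_fin => H.
have : fine (F y) < (z - y) / (z - x) * fine (F x) + (y - x) / (z - x) * fine (F z).
  apply: H; [lra|lra|].
  by rewrite divr_gt0 ?ltr_pdivrMr//=; lra.
rewrite -(ltr_pM2l zx); congr (_ < _).
by field; rewrite gt_eqF.
Qed.

(** Left of zero the function is constantly [+oo], at zero this is part of the class, and at a
    positive point two chords squeeze the function. *)
Lemma Gamma_rcont F x : Gamma F -> F t @[t --> x^'+] --> F x.
Proof.
move=> GF; have [_ _ _ Fneg F0] := GF.
have [xlt0|xgt0|->//] := ltgtP x 0.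
  rewrite (Fneg x xlt0); apply: cvg_near_cst.
  near=> t; rewrite Fneg//.
rewrite (Gamma_EFin GF xgt0); apply/fine_cvgP; split.
  near=> t; rewrite (Gamma_EFin GF)//; near: t.
  by apply: filterS (nbhs_right_gt x) => t /(lt_trans xgt0).
set f := fine \o F.
(* [C1] is the slope of the chord over [[x, x + 1]], an upper bound to the right of [x]; [C2] is the
   slope over [[x / 2, x]], whose extension is a lower bound. *)
set C1 := f (x + 1) - f x; set C2 := (f x - f (x / 2)) / (x / 2).
apply: (@squeeze_cvgr _ _ _ _ (fun t => f x + (t - x) * C2) (fun t => f x + (t - x) * C1)).
- near=> t.
  have xt : x < t by near: t; exact: nbhs_right_gt.
  have t1 : t < x + 1 by near: t; apply: nbhs_right_lt; rewrite ltrDl.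
  have x2 : 0 < x / 2 by rewrite divr_gt0.
  apply/andP; split; last first.
    have := @Gamma_strict3 F x t (x + 1) GF xgt0 xt t1.
    rewrite /C1 /f /=; lra.
  have /= := @Gamma_strict3 F (x / 2) x t GF x2 _ xt.
  move=> /(_ _)/ltW -H.
  rewrite -(ler_pM2l x2) /C2 mulrDr.
  have -> : x / 2 * ((t - x) * ((f x - f (x / 2)) / (x / 2))) = (t - x) * (f x - f (x / 2)).
    by field; lra.
  by have := H _; rewrite /f /=; lra.
- have : f x + (t - x) * C2 @[t --> x^'+] --> f x + (x - x) * C2.
    apply: cvgD; first exact: cvg_cst.
    apply: cvgM; last exact: cvg_cst.
    by apply: cvgB; [exact: cvg_at_right_filter cvg_id|exact: cvg_cst].
  by rewrite subrr mul0r addr0.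
- have : f x + (t - x) * C1 @[t --> x^'+] --> f x + (x - x) * C1.
    apply: cvgD; first exact: cvg_cst.
    apply: cvgM; last exact: cvg_cst.
    by apply: cvgB; [exact: cvg_at_right_filter cvg_id|exact: cvg_cst].
  by rewrite subrr mul0r addr0.
Unshelve. all: by end_near. Qed.

(** Strict convexity is available only on the open half-line; the left end [x = 0] is reached by
    letting [h] decrease to zero. *)
Lemma Gamma_conv3 F x y z a c : Gamma F -> x < y -> y < z ->
  F x = a%:E -> F z = c%:E ->
  (F y <= (((z - y) * a + (y - x) * c) / (z - x))%:E)%E.
Proof.
move=> GF xy yz Fx Fz.
have x_ge0 : 0 <= x by apply: (Gamma_fin_ge0 GF); rewrite Fx ltry.
have y0 : 0 < y by exact: le_lt_trans xy.
have zx : 0 < z - x by rewrite subr_gt0 (lt_trans xy).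
rewrite (Gamma_EFin GF y0) lee_fin ler_pdivlMr// mulrC.
move: x_ge0; rewrite le_eqVlt => /predU1P[x0|x0]; last first.
  by have /ltW := Gamma_strict3 GF x0 xy yz; rewrite Fx Fz.
subst x.
have Fh : fine (F h) @[h --> 0^'+] --> a.
  by have := Gamma_rcont (x := 0) GF; rewrite Fx => /fine_cvgP[].
have ch : h @[h --> 0^'+] --> (0:R) by exact: cvg_at_right_filter cvg_id.
have L : (z - h) * fine (F y) @[h --> 0^'+] --> (z - 0) * fine (F y).
  by apply: cvgM; [apply: cvgB => //; exact: cvg_cst|exact: cvg_cst].
have U : (z - y) * fine (F h) + (y - h) * c @[h --> 0^'+] -->
    (z - y) * a + (y - 0) * c.
  apply: cvgD; first by apply: cvgM => //; exact: cvg_cst.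
  by apply: cvgM; [apply: cvgB => //; exact: cvg_cst|exact: cvg_cst].
apply: (ler_cvg_to L U); near=> h.
have h0 : 0 < h by near: h; exact: nbhs_right_gt.
have hy : h < y by near: h; exact: nbhs_right_lt.
by have /ltW := Gamma_strict3 GF h0 hy yz; rewrite Fz.
Unshelve. all: by end_near. Qed.

(** On the right this is right continuity. On the left either [F] is [+oo], or [F] lies above the
    extended chord over [[x, x + 1]]. *)
Lemma Gamma_lsc F x e : Gamma F -> (e%:E < F x)%E ->
  \forall t \near x, (e%:E < F t)%E.
Proof.
move=> GF eF; have [_ _ _ Fneg _] := GF.
have right : \forall t \near x, x < t -> (e%:E < F t)%E.
  apply: (@Gamma_rcont F x GF [set u | (e%:E < u)%E]).
  by apply: open_nbhs_nbhs; split => //; exact: open_ereal_gt_ereal.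
have left : \forall t \near x, t < x -> (e%:E < F t)%E.
  have [x_le0|x0] := leP x 0.
    by near=> t => tx; rewrite Fneg ?ltry// (lt_le_trans tx).
  have x10 : 0 < x + 1 by rewrite addr_gt0.
  set D := fine (F (x + 1)) - fine (F x).
  have fxt : (fun t => fine (F x) - (x - t) * D) t @[t --> x] -->
      fine (F x) - (x - x) * D.
    apply: cvgB; first exact: cvg_cst.
    by apply: cvgM; [apply: cvgB; [exact: cvg_cst|exact: cvg_id]|exact: cvg_cst].
  have efx : e < fine (F x) - (x - x) * D.
    by rewrite subrr mul0r subr0 -lte_fin -Gamma_EFin.
  have near_e := cvgr_gt _ fxt _ efx.
  near=> t => tx.
  have t0 : 0 < t by near: t; exact: lt_nbhsr.
  rewrite (Gamma_EFin GF t0) lte_fin.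
  apply: (@lt_le_trans _ _ (fine (F x) - (x - t) * D)); first by near: t; exact: near_e.
  have := @Gamma_strict3 F t x (x + 1) GF t0 tx _.
  by rewrite /D ltrDl => /(_ ltr01); lra.
near=> t; have [tx|xt|->//] := ltgtP t x.
- by move: tx; near: t.
- by move: xt; near: t.
Unshelve. all: by end_near. Qed.

Lemma Gamma_affine F r c : Gamma F -> Gamma (fun t => (F t + (c - r * t)%:E)%E).
Proof.
move=> GF; have [FNy Ffin Fconv Fneg F0] := GF; split.
- by move=> t; rewrite lteNye adde_eq_ninfty negb_or/= -ltNye FNy.
- by move=> t t0; rewrite fin_numD Ffin.
- move=> x y p x0 y0 xy p01; have := Fconv x y p x0 y0 xy p01.
  have t0 : 0 < p * x + (1 - p) * y by nra.
  rewrite (Gamma_EFin GF x0) (Gamma_EFin GF y0) (Gamma_EFin GF t0).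
  rewrite -!EFinD !lte_fin => H.
  lra.
- by move=> t /Fneg ->.
- apply: cvgeD => //; first by rewrite fin_num_adde_defl.
  apply: cvg_EFin; first by near=> t.
  apply: cvgB; first exact: cvg_cst.
  apply: cvgM; first exact: cvg_cst.
  exact: cvg_at_right_filter cvg_id.
Unshelve. all: by end_near. Qed.

(** * Conjugates, zeros and growth of functions in the class *)

Lemma conjugate_ub F r t : ((r * t)%:E - F t <= conjugate F r)%E.
Proof. by apply: ereal_sup_ubound; exists t. Qed.

Lemma conjugate_le F r (b : \bar R) :
  (forall t, ((r * t)%:E - F t <= b)%E) -> (conjugate F r <= b)%E.
Proof. by move=> H; apply: ge_ereal_sup => _ [t _ <-]. Qed.

Lemma conjugate_gtNy F r : Gamma F -> (-oo < conjugate F r)%E.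
Proof.
move=> GF; apply: lt_le_trans (conjugate_ub F r 1).
by rewrite (Gamma_EFin GF ltr01) -EFinB ltNyr.
Qed.

(** Two midpoints are needed since [x] may be [0]: convexity makes [F] vanish at the first one,
    [z > 0], and strictness is then contradicted between [z] and [y]. *)
Lemma Gamma_zero_unique F x y : Gamma F -> (forall t, (0 <= F t)%E) ->
  x < y -> F x = 0%E -> F y <> 0%E.
Proof.
move=> GF F_ge0 xy Fx Fy.
have x_ge0 : 0 <= x by apply: (Gamma_fin_ge0 GF); rewrite Fx.
set z := (x + y) / 2.
have [xz zy] : x < z /\ z < y by rewrite /z; lra.
have Fz : F z = 0%E.
  apply/eqP; rewrite eq_le F_ge0 andbT.
  by have := Gamma_conv3 GF xz zy Fx Fy; rewrite !mulr0 addr0 mul0r.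
have z0 : 0 < z by lra.
set w := (z + y) / 2.
have [zw wy] : z < w /\ w < y by rewrite /w; lra.
have w0 : 0 < w by lra.
have := Gamma_strict3 GF z0 zw wy.
rewrite Fz Fy /= !mulr0 addr0; apply/negP; rewrite -leNgt.
by rewrite mulr_ge0//; [lra|rewrite fine_ge0].
Qed.

(** The slope of the rising chord serves as [c]: beyond [y] the function lies above this chord, so
    the supremum defining the conjugate stays below [c * y]. *)
Lemma Gamma_growth F x y a b : Gamma F -> (forall t, (0 <= F t)%E) ->
  x < y -> F x = a%:E -> F y = b%:E -> a < b ->
  exists2 c, 0 < c & (conjugate F c < +oo)%E.
Proof.
move=> GF F_ge0 xy Fx Fy ab.
have yx : 0 < y - x by rewrite subr_gt0.
set c := (b - a) / (y - x).
have c0 : 0 < c by rewrite divr_gt0 // subr_gt0.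
exists c => //; apply: (@le_lt_trans _ _ (c * y)%:E); last exact: ltry.
apply: conjugate_le => t.
have Ft_ge0 := F_ge0 t.
case Ft : (F t) Ft_ge0 => [u||]//; last by rewrite leNye.
rewrite -EFinB !lee_fin => u0.
have [ty|yt] := leP t y.
  have : c * t <= c * y by rewrite ler_pM2l.
  lra.
have := Gamma_conv3 GF xy yt Fx Ft.
have tx : 0 < t - x by lra.
rewrite Fy lee_fin ler_pdivlMr// => H.
have : 0 <= b * (y - x) by rewrite mulr_ge0 ?(ltW yx)// -lee_fin -Fy.
rewrite -(ler_pM2l yx).
have -> : (y - x) * (c * t - u) = (b - a) * t - (y - x) * u.
  by rewrite /c; field; rewrite gt_eqF.
have -> : (y - x) * (c * y) = (b - a) * y.
  by rewrite /c; field; rewrite gt_eqF.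
lra.
Qed.

(** By [Gamma_growth], any increase of [F] would make the conjugate finite at some positive
    argument. So [F] never increases, and a zero at [y] would force another at [y + 1]. *)
Lemma Gamma_endpoint F y : Gamma F -> (forall t, (0 <= F t)%E) ->
  (forall c, 0 < c -> conjugate F c = +oo%E) -> 0 < y ->
  (0 < F y)%E /\ (forall t, t <= y -> (F y <= F t)%E).
Proof.
move=> GF F_ge0 Foo y0.
have mono x z : x <= z -> 0 < z -> (F z <= F x)%E.
  rewrite le_eqVlt => /predU1P[->//|xz] z0; rewrite leNgt; apply/negP => FxFz.
  have Fz := Gamma_EFin GF z0.
  have Fx : F x = (fine (F x))%:E.
    by rewrite fineK// ge0_fin_numE// (lt_trans FxFz)// Fz ltry.
  have [|c c0] := Gamma_growth GF F_ge0 xz Fx Fz.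
    by rewrite -lte_fin -Fx -Fz.
  by rewrite Foo// ltxx.
split; last by move=> t /mono; apply.
rewrite lt_neqAle F_ge0 andbT; apply/negP => /eqP Fy.
have yy1 : y < y + 1 by rewrite ltrDl.
apply: (@Gamma_zero_unique F y (y + 1)) => //.
by apply/eqP; rewrite eq_le F_ge0 andbT Fy mono ?ltW// ltr_wpDr.
Qed.

(** The value of the conjugate at [0] is minus the infimum of [F]; the hypothesis thus encodes that
    this infimum is zero. *)
Lemma conjugate0_inf F e : conjugate F 0 = 0%E -> 0 < e ->
  exists t, (F t < e%:E)%E.
Proof.
move=> F0 e0.
have /(_ e e0) := @ub_ereal_sup_adherent R [set ((0 * t)%:E - F t)%E | t in [set: R]].
rewrite -[ereal_sup _]/(conjugate F 0) F0 => -[//|_ [t _ <-]].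
by rewrite mul0r !sub0e lteN2 => Ft; exists t.
Qed.

Lemma conjugate0_ge0 F : conjugate F 0 = 0%E -> forall t, (0 <= F t)%E.
Proof.
by move=> F0 t; have := conjugate_ub F 0 t; rewrite F0 mul0r sub0e oppe_le0.
Qed.

(** Finiteness of the conjugate at [c > 0] confines near-minimizers to a compact interval; a cluster
    point is a minimizer by lower semicontinuity. *)
Lemma Gamma_argmin F c : Gamma F -> conjugate F 0 = 0%E -> 0 < c ->
  (conjugate F c < +oo)%E -> exists t, F t = 0%E.
Proof.
move=> GF F0 c0 Fc; have F_ge0 := conjugate0_ge0 F0.
have kE : conjugate F c = (fine (conjugate F c))%:E.
  by rewrite fineK// fin_real// Fc conjugate_gtNy.
set k := fine _ in kE.
have /choice[u uP] : forall n : nat, exists t, (F t < n.+1%:R^-1%:E)%E.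
  by move=> n; apply: conjugate0_inf => //; rewrite invr_gt0.
(* The value [v] at a near-minimizer is at most [1], so [c * u n - v <= k] yields the upper
   bound. *)
have u01 n : u n \in `[0, (1 + k) / c].
  have := uP n; case Fun : (F (u n)) => [v||]//; last first.
    by have := F_ge0 (u n); rewrite Fun.
  have u0 : 0 <= u n by apply: (Gamma_fin_ge0 GF); rewrite Fun ltry.
  rewrite lte_fin => vn.
  have v1 : v <= 1 by rewrite (le_trans (ltW vn))// invf_le1// ler1n.
  rewrite in_itv/= u0/= ler_pdivlMr//.
  have := conjugate_ub F c (u n); rewrite kE Fun -EFinB lee_fin.
  lra.
have uA : (u @ \oo) [set` `[0, (1 + k) / c]] by exists 0%N => // n _; exact: u01.
have [t [_ tcl]] := @segment_compact R 0 ((1 + k) / c) (u @ \oo) _ uA.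
(* A positive value at the cluster point would keep [F] above some [e > 0] around [t], whereas
   [F (u n)] is eventually below [e]. *)
exists t; apply/eqP; rewrite eq_le F_ge0 andbT leNgt.
apply/negP => Ft0.
have [e e0 eFt] : exists2 e, 0 < e & (e%:E < F t)%E.
  case Ft : (F t) Ft0 => [v||]// v0; last by exists 1 => //; exact: ltry.
  by exists (v / 2); rewrite ?lte_fin in v0 *; lra.
have [|x [/= x1 x2]] := tcl [set x | (F x < e%:E)%E] _ _ (Gamma_lsc GF eFt).
  have := near_infty_natSinv_lt (PosNum e0).
  by apply: filterS => n /= ne; apply: lt_trans (uP n) _; rewrite lte_fin.
by move: (lt_trans x1 x2); rewrite ltxx.
Qed.

Lemma Gamma_argmin_sep F x e : Gamma F -> (forall t, (0 <= F t)%E) ->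
  F x = 0%E -> 0 < e -> (0 < F (x + e)%R)%E /\ (0 < F (x - e)%R)%E.
Proof.
move=> GF F_ge0 Fx e0; split; rewrite lt_neqAle F_ge0 andbT eq_sym; apply/eqP.
  by apply: (@Gamma_zero_unique F x) => //; rewrite ltrDl.
by move=> /(@Gamma_zero_unique F (x - e) x GF F_ge0); apply => //; rewrite ltrBlDr ltrDl.
Qed.

(** Beyond distance [e] the function dominates the extended chord from its zero [x] to height [m] at
    [x + e] or [x - e]. *)
Lemma Gamma_linear_growth F x e m t : Gamma F -> (forall t, (0 <= F t)%E) ->
  F x = 0%E -> 0 < e -> (m%:E <= F (x + e)%R)%E -> (m%:E <= F (x - e)%R)%E ->
  e <= `|t - x| -> ((m / e * `|t - x|)%:E <= F t)%E.
Proof.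
move=> GF F_ge0 Fx e0 mr ml et.
case Ft : (F t) => [u||]; [|by rewrite leey|by have := F_ge0 t; rewrite Ft].
have xt0 : 0 < `|t - x| by exact: lt_le_trans et.
rewrite lee_fin mulrAC ler_pdivrMr// mulrC.
rewrite mulrC; have [xt|tx] := ltrP x t.
  move: et xt0; rewrite gtr0_norm ?subr_gt0// => et xt0.
  have [xet|xet] := eqVneq (x + e) t.
    by move: mr; rewrite xet Ft lee_fin -xet => mu; have := ler_wpM2l (ltW e0) mu; lra.
  have h1 : x < x + e by rewrite ltrDl.
  have h2 : x + e < t by rewrite lt_neqAle xet; lra.
  have := le_trans mr (Gamma_conv3 GF h1 h2 Fx Ft).
  by rewrite lee_fin ler_pdivlMr//; lra.
move: et xt0; rewrite distrC ger0_norm ?subr_ge0// => et xt0.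
have [xet|xet] := eqVneq t (x - e).
  by move: ml; rewrite -xet Ft lee_fin xet => mu; have := ler_wpM2l (ltW e0) mu; lra.
have h1 : t < x - e by rewrite lt_neqAle xet/=; lra.
have h2 : x - e < x by rewrite ltrBlDr ltrDl.
have := le_trans ml (Gamma_conv3 GF h1 h2 Ft Fx).
by rewrite lee_fin ler_pdivlMr//; lra.
Qed.

(** Quantitative form of the statement that the conjugate has derivative [x] at [0]. For slopes
    below the growth rate [m / e], points further than [e] from [x] cannot raise the supremum above
    the bound. *)
Lemma conjugate_argmin F x e : Gamma F -> (forall t, (0 <= F t)%E) ->
  F x = 0%E -> 0 < e -> exists2 c, 0 < c & forall s, `|s| <= c ->
    ((s * x)%:E <= conjugate F s)%E /\ (conjugate F s <= (s * x + e * `|s|)%:E)%E.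
Proof.
move=> GF F_ge0 Fx e0.
have [pr pl] := Gamma_argmin_sep GF F_ge0 Fx e0.
(* [F (x - e)] may be [+oo], in which case [1] is taken as a real lower bound. *)
have [m m0 [mr ml]] : exists2 m, 0 < m & (m%:E <= F (x + e)%R)%E /\ (m%:E <= F (x - e)%R)%E.
  have H (b : \bar R) : (0 < b)%E -> exists2 m, 0 < m & (m%:E <= b)%E.
    case: b => [b b0||]//; first by exists b.
    by exists 1 => //; rewrite leey.
  have [m1 m10 h1] := H _ pr; have [m2 m20 h2] := H _ pl.
  exists (Num.min m1 m2); first by rewrite lt_min m10.
  split; [apply: le_trans h1|apply: le_trans h2].
    by rewrite lee_fin ge_min lexx.
  by rewrite lee_fin ge_min lexx orbT.
exists (m / e); first exact: divr_gt0.
move=> s sc; split.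
  by have := conjugate_ub F s x; rewrite Fx sube0.
apply: conjugate_le => t.
case Ft : (F t) => [u||]; [|by rewrite leNye|by have := F_ge0 t; rewrite Ft].
rewrite -EFinB lee_fin.
have stx : s * (t - x) <= `|s| * `|t - x| by rewrite -normrM ler_norm.
have [te|et] := leP `|t - x| e.
  have : `|s| * `|t - x| <= `|s| * e by rewrite ler_wpM2l.
  have : 0 <= u by rewrite -lee_fin -Ft.
  lra.
have := Gamma_linear_growth GF F_ge0 Fx e0 mr ml (ltW et).
rewrite Ft lee_fin.
have : `|s| * `|t - x| <= m / e * `|t - x| by rewrite ler_wpM2r.
have : 0 <= e * `|s| by rewrite mulr_ge0// ltW.
lra.
Qed.

(** As [y] is arbitrary, this is the infinite left slope of the conjugate at [0]. Points [t <= y]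
    cost at least [F y >= s * y], and for [t > y] the linear term suffices. *)
Lemma conjugate_endpoint F y : Gamma F -> (forall t, (0 <= F t)%E) ->
  (forall c, 0 < c -> conjugate F c = +oo%E) -> 0 < y ->
  exists2 c, 0 < c & forall s, 0 < s -> s <= c -> (conjugate F (- s)%R <= (- s * y)%:E)%E.
Proof.
move=> GF F_ge0 Foo y0; have [Fy0 Fy] := Gamma_endpoint GF F_ge0 Foo y0.
have FyE := Gamma_EFin GF y0; set m := fine _ in FyE.
have m0 : 0 < m by rewrite -lte_fin -FyE.
exists (m / y); first exact: divr_gt0.
move=> s s0; rewrite ler_pdivlMr// => sy; apply: conjugate_le => t.
case Ft : (F t) => [u||]; [|by rewrite leNye|by have := F_ge0 t; rewrite Ft].
rewrite -EFinB lee_fin.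
have t0 : 0 <= t by apply: (Gamma_fin_ge0 GF); rewrite Ft ltry.
have u0 : 0 <= u by rewrite -lee_fin -Ft.
have [ty|yt] := leP t y.
  have : m <= u by rewrite -lee_fin -Ft -FyE Fy.
  have : 0 <= s * t by rewrite mulr_ge0// ltW.
  lra.
have : s * y <= s * t by rewrite ler_pM2l// ltW.
lra.
Qed.

(* The Fenchel-Young gap, meaningful only when [conjugate gamma r] is finite. *)
Definition gap gamma r t : \bar R := (gamma t + (fine (conjugate gamma r) - r * t)%:E)%E.

Lemma gap_Gamma gamma r : Gamma gamma -> Gamma (gap gamma r).
Proof. exact: Gamma_affine. Qed.

(** Translation principle: the behaviour of the conjugate of [gamma] at [r] becomes that of the
    conjugate of a nonnegative function at [0]. *)
Lemma conjugate_gap gamma r s : Gamma gamma -> conjugate gamma r \is a fin_num ->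
  conjugate (gap gamma r) s = (conjugate gamma (r + s)%R - conjugate gamma r)%E.
Proof.
move=> Gg rfin; rewrite -(fineK rfin).
have gNy t : gamma t != -oo%E by rewrite -ltNye (Gamma_gtNy _ Gg).
apply/eqP; rewrite eq_le; apply/andP; split.
  apply: conjugate_le => t; rewrite leeBrDr//; apply: le_trans (conjugate_ub gamma _ t).
  rewrite /gap; case: (gamma t) (gNy t) => [u||]// _.
  by rewrite lee_fin; lra.
rewrite leeBlDr//; apply: conjugate_le => t.
rewrite -leeBlDr//; apply: le_trans (conjugate_ub _ _ t).
rewrite /gap; case: (gamma t) (gNy t) => [u||]// _.
by rewrite lee_fin; lra.
Qed.

Lemma conjugate_gap0 gamma r : Gamma gamma -> conjugate gamma r \is a fin_num ->
  conjugate (gap gamma r) 0 = 0%E.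
Proof. by move=> Gg rfin; rewrite conjugate_gap// addr0 subee. Qed.

Lemma le_conjugate gamma r s : Gamma gamma -> r <= s ->
  (conjugate gamma r <= conjugate gamma s)%E.
Proof.
move=> Gg rs; apply: conjugate_le => t; apply: le_trans (conjugate_ub _ _ t).
case gt : (gamma t) => [u||]; [|by rewrite leNye|by have := Gamma_gtNy t Gg; rewrite gt].
have t0 : 0 <= t by apply: (Gamma_fin_ge0 Gg); rewrite gt ltry.
by rewrite -!EFinB lee_fin lerB// ler_wpM2r.
Qed.

(** * Finiteness and differentiability of the conjugate near a point *)

(** The conjugate is nondecreasing and never [-oo], so only finiteness on the right matters; the
    sequential form gives a countable, measurable condition. *)
Lemma near_conjugate_fin_num gamma r : Gamma gamma ->
  (\forall s \near r, conjugate gamma s \is a fin_num) <->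
  exists n : nat, (conjugate gamma (r + n.+1%:R^-1)%R < +oo)%E.
Proof.
move=> Gg; split => [/nbhs_ballP[e /= e0 H]|[n Hn]].
  have [n _ /(_ n (leqnn n)) ne] := near_infty_natSinv_lt (PosNum e0).
  exists n; have : conjugate gamma (r + n.+1%:R^-1) \is a fin_num.
    by apply: H; rewrite /ball/= opprD addrA subrr sub0r normrN gtr0_norm.
  by move=> /fin_numPlt/andP[].
have : \forall s \near r, s < r + n.+1%:R^-1 by apply: lt_nbhsl; rewrite ltrDl.
apply: filterS => s sr; rewrite fin_real// conjugate_gtNy//=.
by apply: le_lt_trans Hn; apply: le_conjugate => //; exact: ltW.
Qed.

Lemma conjugate_gap_argmin gamma r : Gamma gamma ->
  (\forall s \near r, conjugate gamma s \is a fin_num) ->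
  exists t, gap gamma r t = 0%E.
Proof.
move=> Gg nfin; have rfin := nbhs_singleton nfin.
have /(near_conjugate_fin_num _ Gg)[n nfin'] := nfin.
have GF := gap_Gamma r Gg; have F0 := conjugate_gap0 Gg rfin.
apply: (Gamma_argmin GF F0 (c := n.+1%:R^-1)); first by rewrite invr_gt0.
by rewrite conjugate_gap// -(fineK rfin) lteBlDr// addye.
Qed.

Lemma cvg_conjugate_quotient gamma r t : Gamma gamma ->
  (\forall s \near r, conjugate gamma s \is a fin_num) ->
  gap gamma r t = 0%E ->
  h^-1 * (fine (conjugate gamma (h + r)) - fine (conjugate gamma r))
    @[h --> 0^'] --> t.
Proof.
move=> Gg nfin Ft; have rfin := nbhs_singleton nfin.
have GF := gap_Gamma r Gg; have F0 := conjugate_gap0 Gg rfin.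
have F_ge0 := conjugate0_ge0 F0.
apply/cvgrPdist_le => e e0.
have [c c0 Hc] := conjugate_argmin GF F_ge0 Ft e0.
near=> h.
have h0 : h != 0 by near: h; exact: nbhs_dnbhs_neq.
have hc : `|h| <= c.
  near: h; apply: nbhs_dnbhs; apply: filterS (nbhs0_lt c0) => x; exact: ltW.
have hfin : conjugate gamma (h + r) \is a fin_num.
  near: h; apply: nbhs_dnbhs.
  have : h + r @[h --> (0 : R)] --> 0 + r by apply: cvgD; [exact: cvg_id|exact: cvg_cst].
  by rewrite add0r => /(_ _ nfin).
have [] := Hc h hc; rewrite conjugate_gap// (addrC r).
rewrite -(fineK rfin) -(fineK hfin) -EFinB !lee_fin /=.
set u := fine _; set v := fine _ => H1 H2.
have -> : t - h^-1 * (u - v) = h^-1 * (h * t - (u - v)) by field.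
rewrite normrM normfV ler_pdivrMl ?normr_gt0// (mulrC `|h|).
rewrite ler_norml; apply/andP; split; first lra.
have : 0 <= e * `|h| by rewrite mulr_ge0// ltW.
lra.
Unshelve. all: by end_near. Qed.

Lemma derive_conjugate gamma r t : Gamma gamma ->
  (\forall s \near r, conjugate gamma s \is a fin_num) ->
  gap gamma r t = 0%E ->
  differentiable_at (conjugate gamma) r /\
  derive1 (fine \o conjugate gamma) r = t.
Proof.
move=> Gg nfin Ft; have cv := cvg_conjugate_quotient Gg nfin Ft.
split; last by rewrite /derive1; apply/cvg_lim => //; exact: cv.
split => //; apply/cvg_ex; exists t.
rewrite [X in X @ _](_ : _ = fun h => h^-1 *
  (fine (conjugate gamma (h + r)) - fine (conjugate gamma r))) //.
by apply/funext => h; rewrite /= /GRing.scale/= mulr1.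
Qed.

Lemma conjugate_convex gamma r s e : Gamma gamma -> 0 <= e <= 1 ->
  (conjugate gamma ((1 - e) * r + e * s)%R <=
   (1 - e)%:E * conjugate gamma r + e%:E * conjugate gamma s)%E.
Proof.
move=> Gg /andP[e0 e1]; apply: conjugate_le => t.
have [gy|gy] := eqVneq (gamma t) +oo%E; first by rewrite gy leNye.
have -> : ((((1 - e) * r + e * s) * t)%:E - gamma t =
    (1 - e)%:E * ((r * t)%:E - gamma t) + e%:E * ((s * t)%:E - gamma t))%E.
  case: (gamma t) gy (Gamma_gtNy t Gg) => [u||]// _ _.
  by rewrite -!EFinB -!EFinM -EFinD; congr EFin; ring.
by apply: leeD; apply: lee_wpmul2l; rewrite ?lee_fin ?subr_ge0//; exact: conjugate_ub.
Qed.

(** Right continuity allows a countable supremum. The rationals approach [t] from above, since at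
    [t = 0] every point on the left has value [+oo]. *)
Lemma conjugate_rat gamma r : Gamma gamma ->
  conjugate gamma r = ereal_sup [set ((r * ratr q)%:E - gamma (ratr q))%E | q in [set: rat]].
Proof.
move=> Gg; apply/eqP; rewrite eq_le; apply/andP; split; last first.
  by apply: ge_ereal_sup => _ [q _ <-]; exact: conjugate_ub.
apply: conjugate_le => t.
pose q n := xget 0 [set q : rat | t < ratr q /\ ratr q < t + n.+1%:R^-1].
have qP n : t < ratr (q n) /\ ratr (q n) < t + n.+1%:R^-1.
  rewrite /q; case: xgetP => // /= nq; exfalso.
  have : t < t + n.+1%:R^-1 by rewrite ltrDl.
  move=> /rat_in_itvoo[p]; rewrite in_itv/= => /andP[p1 p2].
  exact: (nq p).
have qt : ratr (q n) @[n --> \oo] --> t.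
  apply: (@squeeze_cvgr _ _ _ _ (fun=> t) (fun n => t + n.+1%:R^-1)).
  - by apply: nearW => n; have [/ltW-> /ltW->] := qP n.
  - exact: cvg_cst.
  - by rewrite -[X in _ --> X]addr0; apply: cvgD; [exact: cvg_cst|exact: cvg_harmonic].
have gq : gamma (ratr (q n)) @[n --> \oo] --> gamma t.
  apply: cvg_comp (Gamma_rcont (x := t) Gg).
  by apply: cvg_at_right_seq => // n; have [] := qP n.
have : ((r * ratr (q n))%:E - gamma (ratr (q n)))%E @[n --> \oo] --> ((r * t)%:E - gamma t)%E.
  apply: cvgeB => //.
  by apply: cvg_EFin; [exact: nearW|apply: cvgM => //; exact: cvg_cst].
move=> cv; rewrite -(cvg_lim _ cv)//; apply: lime_le; first by apply/cvg_ex; eexists; exact: cv.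
by apply: nearW => n; apply: ereal_sup_ubound; exists (q n).
Qed.

Lemma not_near_conjugate gamma r : Gamma gamma ->
  ~ (\forall s \near r, conjugate gamma s \is a fin_num) ->
  forall c, 0 < c -> conjugate gamma (r + c) = +oo%E.
Proof.
move=> Gg nnear c c0; apply: contrapT => /eqP; rewrite -ltey => cfin.
apply: nnear; apply/(near_conjugate_fin_num _ Gg).
have [n _ /(_ n (leqnn n))/= nc] := near_infty_natSinv_lt (PosNum c0).
exists n; apply: le_lt_trans cfin; apply: le_conjugate => //.
by rewrite lerD2l ltW.
Qed.

(* The convexity defect along a segment leaving an endpoint of the domain is not
   of the order of the step, as the conjugate has infinite slope there. *)
Lemma conjugate_quotient_dvg gamma r s : Gamma gamma ->
  conjugate gamma r \is a fin_num ->
  (\forall u \near s, conjugate gamma u \is a fin_num) ->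
  ~ (\forall u \near r, conjugate gamma u \is a fin_num) ->
  (n.+1%:R%:E * ((1 - n.+1%:R^-1)%:E * conjugate gamma r
      + n.+1%:R^-1%:E * conjugate gamma s
      - conjugate gamma ((1 - n.+1%:R^-1) * r + n.+1%:R^-1 * s)%R))%E
    @[n --> \oo] --> +oo%E.
Proof.
move=> Gg rfin snear nrnear; have roo := not_near_conjugate Gg nrnear.
have sfin := nbhs_singleton snear.
have sr : s < r.
  rewrite ltNge; apply/negP => rs.
  have /(near_conjugate_fin_num _ Gg)[n] := snear.
  apply/negP; rewrite -leNgt -(roo n.+1%:R^-1) ?invr_gt0//.
  by apply: le_conjugate => //; rewrite lerD2r.
have GF := gap_Gamma r Gg; have F0 := conjugate_gap0 Gg rfin.
have F_ge0 := conjugate0_ge0 F0.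
have Foo c : 0 < c -> conjugate (gap gamma r) c = +oo%E.
  by move=> c0; rewrite conjugate_gap// roo// -(fineK rfin).
apply/cvgeyPge => A.
set f := fine (conjugate gamma r); set f' := fine (conjugate gamma s).
(* This choice gives [M * (r - s) >= A - f' + f]; the maximum with [1] provides the positivity
   required by [conjugate_endpoint]. *)
pose M := Num.max 1 ((A - f' + f) / (r - s)).
have M0 : 0 < M by rewrite lt_max ltr01.
have [c c0 cP] := conjugate_endpoint GF F_ge0 Foo M0.
have rs0 : 0 < r - s by rewrite subr_gt0.
have crs0 : 0 < c / (r - s) by rewrite divr_gt0.
have [N _ NP] := near_infty_natSinv_lt (PosNum crs0).
exists N => // n /NP /= nc; set e : R := n.+1%:R^-1 in nc *.
have e0 : 0 < e by rewrite invr_gt0.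
have -> : ((1 - e) * r + e * s = r + - (e * (r - s)))%R by ring.
have := cP (e * (r - s)) (mulr_gt0 e0 rs0).
rewrite conjugate_gap// => /(_ _).
have /[swap] /[apply] : (e * (r - s) <= c)%R.
  by rewrite -ler_pdivlMr// ltW.
set w := conjugate gamma (r + - (e * (r - s))).
have : (-oo < w)%E by exact: conjugate_gtNy.
rewrite -(fineK rfin) -(fineK sfin) -/f -/f'.
case: w => [w||]//= _; rewrite -EFinB lee_fin => H.
rewrite -!EFinM lee_fin.
have -> : n.+1%:R = e^-1 by rewrite /e invrK.
rewrite ler_pdivlMl//.
have H2 : (A - f' + f) <= M * (r - s).
  by rewrite -ler_pdivrMr// le_max lexx orbT.
have := ler_wpM2l (ltW e0) H2.
lra.
Qed.

(** Extended-real quotients along a fixed sequence keep the derivative measurable in a parameter;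
    finiteness holds only from some rank on. *)
Lemma cvg_conjugate_seq gamma r t : Gamma gamma ->
  (\forall s \near r, conjugate gamma s \is a fin_num) ->
  gap gamma r t = 0%E ->
  (n.+1%:R%:E * (conjugate gamma (r + n.+1%:R^-1)%R - conjugate gamma r))%E
    @[n --> \oo] --> t%:E.
Proof.
move=> Gg rnear Ft; have rfin := nbhs_singleton rnear.
have := cvg_dnbhs_at_right (cvg_conjugate_quotient Gg rnear Ft).
have n0 : (n.+1%:R^-1 : R) @[n --> \oo] --> 0^'+.
  by apply: cvg_at_right_seq; [move=> n; rewrite invr_gt0|exact: cvg_harmonic].
move=> q; have /= cv := cvg_comp _ _ n0 q => {q}.
have nearfin : \forall n \near \oo, conjugate gamma (r + n.+1%:R^-1) \is a fin_num.
  have : r + n.+1%:R^-1 @[n --> \oo] --> r + 0.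
    by apply: cvgD; [exact: cvg_cst|exact: cvg_harmonic].
  by rewrite addr0 => /(_ _ rnear).
apply/fine_cvgP; split.
  by apply: filterS nearfin => n nfin; rewrite fin_numM// fin_numB nfin.
apply: cvg_trans cv; apply: near_eq_cvg; apply: filterS nearfin => n nfin /=.
by rewrite -(fineK rfin) -(fineK nfin)/= invrK (addrC r).
Qed.

End Gamma_theory.

(** * Measurability of integrands and convergence in measure *)

(** The selector has countably many values, so a preimage is a countable union of pieces, indexed
    here through [unpickle]. *)
Lemma measurable_fun_int_selector {d} {T : measurableType d} {d'} {U : measurableType d'}
    (h : T -> int) (f : int -> T -> U) :
  (forall k, measurable (h @^-1` [set k])) ->
  (forall k, measurable_fun setT (f k)) ->
  measurable_fun setT (fun x => f (h x) x).
Proof.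
move=> mh mf _ B mB; rewrite setTI.
rewrite [X in measurable X](_ : _ = \bigcup_(n : nat)
  if unpickle n is Some k then h @^-1` [set k] `&` f k @^-1` B else set0).
  apply: bigcupT_measurable => n; case: unpickle => // k.
  by apply: measurableI => //; rewrite -[X in measurable X]setTI; exact: mf.
apply/seteqP; split => x /=.
  by move=> Bx; exists (pickle (h x)) => //; rewrite pickleK.
by move=> [n _]; case: unpickle => // k [/= -> ].
Qed.

Section integrand_measurability.
Context {disp : measure_display} {Z : measurableType disp} {R : realType}.
Variable beta : Z -> R -> \bar R.
Hypothesis hbeta : integrand_class beta.

(** Step functions approaching [g] from the right reduce the claim, by right continuity, to
    measurability at fixed arguments. *)
Lemma measurable_integrand (g : Z -> R) : measurable_fun setT g ->
  measurable_fun setT (fun z => beta z (g z)).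
Proof.
move=> mg; have [mbeta Gbeta] := hbeta.
(* [t n (h n z)] is the right end of the grid cell containing [g z]; the [+ 1] keeps it strictly
   above [g z]. *)
pose t (n : nat) (k : int) : R := (k + 1)%:~R / n.+1%:R.
pose h n z := Num.floor (n.+1%:R * g z).
apply: (emeasurable_fun_cvg (fun n z => beta z (t n (h n z)))).
  move=> n; apply: (measurable_fun_int_selector (f := fun k z => beta z (t n k))) => k;
    last exact: mbeta.
  rewrite [X in measurable X](_ : _ = (fun z => n.+1%:R * g z) @^-1` `[k%:~R, (k + 1)%:~R[).
    by rewrite -[X in measurable X]setTI; apply: measurable_funM => //.
  apply/seteqP; split => z /=; rewrite in_itv/=.
    by move=> <-; exact: floor_itv.
  by move=> /floor_def.
move=> z _.
have Hx x n : x < t n (Num.floor (n.+1%:R * x)) <= x + n.+1%:R^-1.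
  have /andP[f1 f2] := floor_itv (n.+1%:R * x).
  rewrite /t ltr_pdivlMr// ler_pdivrMr// mulrDl mulVf// mulrC f2/=.
  by rewrite rmorphD/= rmorph1 lerD2r.
apply: cvg_comp (Gamma_rcont (x := g z) (Gbeta z)).
apply: cvg_at_right_seq; first by move=> n; have /andP[] := Hx (g z) n.
apply: (@squeeze_cvgr _ _ _ _ (fun=> g z) (fun n => g z + n.+1%:R^-1)).
- by apply: nearW => n; have /andP[/ltW-> ->] := Hx (g z) n.
- exact: cvg_cst.
- by rewrite -[X in _ --> X]addr0; apply: cvgD; [exact: cvg_cst|exact: cvg_harmonic].
Qed.

Lemma measurable_conjugate (r : Z -> R) : measurable_fun setT r ->
  measurable_fun setT (fun z => conjugate (beta z) (r z)).
Proof.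
move=> mr; have [mbeta Gbeta] := hbeta.
(* Indices that decode to no rational yield [0], still an admissible point of the supremum. *)
pose q n : R := if unpickle n is Some q then ratr q else 0.
rewrite [X in measurable_fun _ X](_ : _ =
   (fun z => esups (fun n => (r z * q n)%:E - beta z (q n))%E 0)).
  apply: (measurable_fun_esups (f := fun n z => ((r z * q n)%:E - beta z (q n))%E)) => n.
  apply: emeasurable_funB => //.
  by apply/measurable_EFinP; apply: measurable_funM.
apply/funext => z; apply/eqP; rewrite eq_le; apply/andP; split; last first.
  by apply: ge_ereal_sup => _ [n _ <-]; exact: conjugate_ub.
rewrite conjugate_rat//; apply: ge_ereal_sup => _ [p _ <-].
by apply: ereal_sup_ubound; exists (pickle p) => //=; rewrite /q pickleK.
Qed.

End integrand_measurability.

(** * From vanishing integrals to vanishing measures *)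

Section measure_lemmas.
Context {disp : measure_display} {Z : measurableType disp} {R : realType}.
Variable mu : {measure set Z -> \bar R}.
Local Open Scope ereal_scope.

Lemma near_lt_cvge0 (u : nat -> \bar R) (e : R) : (0 < e)%R ->
  u n @[n --> \oo] --> 0 -> \forall n \near \oo, u n < e%:E.
Proof.
move=> e0 u0; apply: (u0 [set x | x < e%:E]).
by apply: open_nbhs_nbhs; split; [exact: open_ereal_lt_ereal|rewrite /= lte_fin].
Qed.

Lemma cvge0_le (u : nat -> \bar R) : (forall n, 0 <= u n) ->
  (forall e : R, (0 < e)%R -> \forall n \near \oo, u n <= e%:E) ->
  u n @[n --> \oo] --> 0.
Proof.
move=> u_ge0 ue; apply/fine_cvgP; split.
  by apply: filterS (ue 1%R ltr01) => n un; rewrite ge0_fin_numE// (le_lt_trans un)// ltry.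
apply/cvgrPdist_le => e e0; apply: filterS (ue e e0) => n un /=.
rewrite sub0r normrN ger0_norm ?fine_ge0//.
by rewrite -lee_fin fineK// ge0_fin_numE// (le_lt_trans un)// ltry.
Qed.

Lemma measure_le_null (A B N : set Z) : measurable A -> measurable B ->
  mu.-negligible N -> A `<=` B `|` N -> mu A <= mu B.
Proof.
move=> mA mB [N' [mN' N'0 NN']] AB.
apply: (@le_trans _ _ (mu (B `|` N'))).
  apply: le_measure; rewrite ?inE//; first exact: measurableU.
  by move=> z /AB[]; [left|right; exact: NN'].
by rewrite -[leRHS]adde0 -N'0; exact: measureU2.
Qed.

(** The part of [Y] where [m] is small has small measure by continuity from above, as [mu Y] is
    finite; Markov's inequality controls the rest of [A n]. *)
Lemma measure_cvg0_of_integral (Y : set Z) (m : Z -> \bar R)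
    (h : nat -> Z -> \bar R) (A : nat -> set Z) :
  measurable Y -> mu Y < +oo -> measurable_fun setT m ->
  (forall n, measurable_fun setT (h n)) ->
  \int[mu]_z `|h n z| @[n --> \oo] --> 0 ->
  (forall n, measurable (A n)) -> (forall n, A n `<=` Y) ->
  {ae mu, forall z, Y z -> 0 < m z} ->
  (forall n, {ae mu, forall z, A n z -> m z <= `|h n z|}) ->
  mu (A n) @[n --> \oo] --> 0.
Proof.
move=> mY Yoo mm mh h0 mA AY m0 mhA.
pose B k := Y `&` [set z | m z <= k.+1%:R^-1%:E].
have mB k : measurable (B k).
  by apply: measurableI => //; rewrite -[X in measurable X]setTI; exact: emeasurable_fun_infty_c.
have B0 : mu (B k) @[k --> \oo] --> 0.
  have mIB : measurable (\bigcap_k B k) by exact: bigcapT_measurable.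
  rewrite (_ : 0 = mu (\bigcap_k B k)).
    apply: nonincreasing_cvg_mu => //.
      by apply: le_lt_trans Yoo; apply: le_measure; rewrite ?inE//; move=> z [].
    move=> i j ij; apply/subsetPset => z [Yz /= mz]; split => //=.
    by apply: (le_trans mz); rewrite lee_fin lef_pV2 ?posrE// ler_nat ltnS.
  apply/esym/eqP; rewrite eq_le measure_ge0 andbT.
  rewrite -(measure0 mu); apply: measure_le_null m0 _ => // z Bz; right.
  have [Yz _] := Bz 0%N I => /(_ Yz) mz.
  have mz0 : m z <= 0.
    case mzE : (m z) mz => [v||]//; last by have [_] := Bz 0%N I; rewrite /= mzE.
    rewrite lte_fin => v0.
    have [n _ /(_ n (leqnn n))/= nv] := near_infty_natSinv_lt (PosNum v0).
    have [_ /=] := Bz n I; rewrite mzE lee_fin => vn.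
    by move: (le_lt_trans vn nv); rewrite /= ltxx.
  by move: (le_lt_trans mz0 mz); rewrite ltxx.
apply: cvge0_le => // e e0.
have e20 : (0 < e / 2)%R by rewrite divr_gt0.
have [k _ /(_ k (leqnn k))/= Bk] := near_lt_cvge0 e20 B0.
have k0 : (0 < k.+1%:R^-1 :> R)%R by rewrite invr_gt0.
have e20k : (0 < k.+1%:R^-1 * (e / 2))%R by rewrite mulr_gt0.
apply: filterS (near_lt_cvge0 e20k h0) => n hn.
pose C := [set z | k.+1%:R^-1%:E <= `|h n z|].
have mC : measurable C.
  rewrite -[C]setTI; apply: emeasurable_fun_c_infty => //.
  by apply: measurableT_comp.
have muC : mu C <= (e / 2)%:E.
  have := le_integral_abse mu measurableT (mh n) k0; rewrite setTI => H.
  rewrite -(@lee_pmul2l _ k.+1%:R^-1%:E)//; apply: (le_trans H).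
  by rewrite -EFinM ltW.
apply: (@le_trans _ _ (mu (B k `|` C))).
  apply: measure_le_null (mhA n) _ => //; first exact: measurableU.
  move=> z Az; have [mz|mz] := leP (m z) k.+1%:R^-1%:E.
    by left; left; split => //; exact: (AY n).
  have [Cz|Cz] := pselect (C z); first by left; right.
  right => /(_ Az) mzh; apply: Cz; rewrite /C/=.
  exact: le_trans (ltW mz) mzh.
apply: (le_trans (measureU2 mu (mB k) mC)).
by rewrite [e]splitr EFinD leeD// ltW.
Qed.

End measure_lemmas.

(** * Local convergence in measure on a sigma-finite space *)

Section local_convergence.
Context {disp : measure_display} {Z : measurableType disp} {R : realType}.
Variable mu : {sigma_finite_measure set Z -> \bar R}.
Local Open Scope ereal_scope.

Lemma measure0_of_cvg (X : set Z) (A B : nat -> set Z) :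
  measurable X -> (forall n, measurable (A n)) -> (forall n, measurable (B n)) ->
  (forall n, X `<=` A n `|` B n) ->
  mu (A n) @[n --> \oo] --> 0 -> mu (B n) @[n --> \oo] --> 0 -> mu X = 0.
Proof.
move=> mX mA mB XAB A0 B0; apply/eqP; rewrite eq_le measure_ge0 andbT.
have AB0 : (mu (A n) + mu (B n)) @[n --> \oo] --> 0.
  by rewrite -[X in _ --> X]adde0; exact: cvgeD.
rewrite -(cvg_lim _ AB0)//; apply: lime_ge; first by apply/cvg_ex; exists 0.
apply: nearW => n; apply: le_trans (measureU2 mu (mA n) (mB n)).
by apply: le_measure; rewrite ?inE//; exact: measurableU.
Qed.

Lemma measurable_dist_gt (f g : Z -> R) (e : R) : measurable_fun setT f ->
  measurable_fun setT g -> measurable [set z | (e < `|f z - g z|)%R].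
Proof.
move=> mf mg; rewrite -[X in measurable X]setTI.
have m : measurable_fun setT (fun z => `|f z - g z|)%R.
  by apply: measurableT_comp => //; exact: measurable_funB.
have -> : [set z | (e < `|f z - g z|)%R] = (fun z => `|f z - g z|)%R @^-1` `]e, +oo[%classic.
  by apply/seteqP; split => z /=; rewrite in_itv/= andbT.
by apply: m.
Qed.

Lemma cvg_locally_in_measure_unique (gs : nat -> Z -> R) (f1 f2 : Z -> R) :
  (forall n, measurable_fun setT (gs n)) ->
  measurable_fun setT f1 -> measurable_fun setT f2 ->
  cvg_locally_in_measure mu gs f1 -> cvg_locally_in_measure mu gs f2 ->
  f1 = f2 %[ae mu].
Proof.
move=> mg mf1 mf2 c1 c2.
have [F TF /all_and2[mF muFoo]] := sigma_finiteT mu.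
pose X i (k : nat) := F i `&` [set z | (k.+1%:R^-1 < `|f1 z - f2 z|)%R].
have X0 i k : mu.-negligible (X i k).
  have mX : measurable (X i k) by apply: measurableI => //; exact: measurable_dist_gt.
  apply/negligibleP => //.
  pose e : R := (k.+1%:R^-1 / 2)%R.
  have e0 : (0 < e)%R by rewrite divr_gt0.
  apply: (measure0_of_cvg mX) (c1 _ _ (mF i) (muFoo i) e0) (c2 _ _ (mF i) (muFoo i) e0).
  - by move=> n; apply: measurableI => //; exact: measurable_dist_gt.
  - by move=> n; apply: measurableI => //; exact: measurable_dist_gt.
  - move=> n z [Fz /= zk]; have [h1|h1] := ltP e `|gs n z - f1 z|%R; first by left.
    right; split => //=; rewrite ltNge; apply/negP => h2.
    have : (`|f1 z - f2 z| <= `|gs n z - f1 z| + `|gs n z - f2 z|)%R.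
      by rewrite [leRHS]addrC (distrC _ (f1 z)) -(subrKA (gs n z)) addrC; exact: ler_normD.
    move: zk h1 h2; rewrite /e.
    move: (k.+1%:R^-1)%R `|f1 z - f2 z|%R => w p.
    by move: `|gs n z - f1 z|%R `|gs n z - f2 z|%R => q r; lra.
have := @negligible_bigcup _ _ _ mu (fun i => \bigcup_k X i k) (fun i => negligible_bigcup (X0 i)).
apply: negligibleS => z /= /not_implyP[_ f12].
have : [set: Z] z by [].
rewrite TF => -[i _ Fz]; exists i => //.
have d0 : (0 < `|f1 z - f2 z|)%R.
  by rewrite normr_gt0 subr_eq0; apply/eqP.
have [k _ /(_ k (leqnn k))/= kd] := near_infty_natSinv_lt (PosNum d0).
by exists k.
Qed.

(** Where [g <= k], points with [gs n > k + 1] lie further than [1 / 2] from the limit. Each piece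
    [X i k] is thus covered by two sets of vanishing measure. *)
Lemma measure0_of_escape (gs : nat -> Z -> R) (g : Z -> R) (A : set Z) :
  measurable A -> (forall n, measurable_fun setT (gs n)) -> measurable_fun setT g ->
  cvg_locally_in_measure mu gs g ->
  (forall (Y : set Z) (M : R), measurable Y -> Y `<=` A -> mu Y < +oo -> (0 < M)%R ->
     mu (Y `&` [set z | (gs n z <= M)%R]) @[n --> \oo] --> 0) ->
  mu A = 0.
Proof.
move=> mA mgs mg cg esc.
have [F TF /all_and2[mF muFoo]] := sigma_finiteT mu.
have mle (f : Z -> R) (c : R) : measurable_fun setT f -> measurable [set z | (f z <= c)%R].
  move=> mf; have -> : [set z | (f z <= c)%R] = setT `&` f @^-1` `]-oo, c]%classic.
    by rewrite setTI; apply/seteqP; split => z /=; rewrite in_itv/=.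
  exact: mf.
pose X i (k : nat) := A `&` F i `&` [set z | (g z <= k%:R)%R].
have X0 i k : mu.-negligible (X i k).
  have mX : measurable (X i k) by apply: measurableI; [exact: measurableI|exact: mle].
  have muX : mu (X i k) < +oo.
    by apply: le_lt_trans (muFoo i); apply: le_measure; rewrite ?inE// => z [[]].
  apply/negligibleP => //.
  have k0 : (0 < k%:R + 1 :> R)%R by rewrite ltr_wpDl.
  apply: (measure0_of_cvg mX) (esc _ _ mX _ muX k0) (cg _ (2^-1)%R mX muX _) => //.
  - by move=> n; apply: measurableI => //; exact: mle.
  - by move=> n; apply: measurableI => //; exact: measurable_dist_gt.
  - move=> n z Xz; have [h1|h1] := leP (gs n z) (k%:R + 1)%R; first by left.
    right; split => //=; have [_ /= gz] := Xz.
    rewrite gtr0_norm; lra.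
  - by move=> z [[]].
apply/negligibleP => //.
have := @negligible_bigcup _ _ _ mu (fun i => \bigcup_k X i k) (fun i => negligible_bigcup (X0 i)).
apply: negligibleS => z Az.
have : [set: Z] z by [].
rewrite TF => -[i _ Fz]; exists i => //.
by exists (Num.truncn (g z)).+1 => //; split => //=; exact/ltW/truncnS_gt.
Qed.

End local_convergence.

(** * Integrability under the convention for infinite positive parts *)

Section eintegral_theory.
Context {disp : measure_display} {Z : measurableType disp} {R : realType}.
Variable mu : {measure set Z -> \bar R}.
Local Open Scope ereal_scope.

Lemma integrable_of_funeposneg (f : Z -> \bar R) : measurable_fun setT f ->
  \int[mu]_z f^\+ z < +oo -> \int[mu]_z f^\- z < +oo ->
  mu.-integrable setT f.
Proof.
move=> mf fp fn; apply/integrableP; split => //.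
have -> : (fun z => `|f z|) = (fun z => f^\+ z + f^\- z).
  by rewrite -[LHS]/(abse \o f) fune_abse.
rewrite ge0_integralD//; [|exact: measurable_funepos|exact: measurable_funeneg].
exact: lte_add_pinfty.
Qed.

Lemma eintegral_integrable (f : Z -> \bar R) : mu.-integrable setT f ->
  eintegral mu f = \int[mu]_z f z.
Proof.
move=> fi; rewrite /eintegral ifF//; apply/negbTE.
by rewrite -ltey; apply: integrable_lty => //; exact: integrable_funepos.
Qed.

Lemma eintegral_gtNy_integrable (f : Z -> \bar R) : measurable_fun setT f ->
  \int[mu]_z f^\+ z < +oo -> -oo < eintegral mu f -> mu.-integrable setT f.
Proof.
move=> mf fp; rewrite /eintegral ifF; last by apply/negbTE; rewrite -ltey.
rewrite integralE => H; apply: integrable_of_funeposneg => //.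
rewrite ltey; apply/eqP => fn; move: H; rewrite fn.
by rewrite addeNy// ltxx.
Qed.

Lemma eintegral_fin_num_integrable (f : Z -> \bar R) : measurable_fun setT f ->
  eintegral mu f \is a fin_num -> mu.-integrable setT f.
Proof.
move=> mf /fin_numPlt/andP[fNy foo]; apply: eintegral_gtNy_integrable => //.
rewrite ltey; apply/eqP => fE; by move: foo; rewrite /eintegral fE eqxx ltxx.
Qed.

(** Meant for multipliers on a segment: convexity supplies the majorant [h], and optimality of the
    dual solution the bound from below. *)
Lemma eintegral_ae_le_integrable (f h : Z -> \bar R) : measurable_fun setT f ->
  mu.-integrable setT h -> {ae mu, forall z, f z <= h z} ->
  -oo < eintegral mu f -> mu.-integrable setT f.
Proof.
move=> mf hi fh; apply: eintegral_gtNy_integrable => //.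
have [mh _] := integrableP _ _ _ hi.
apply: (@le_lt_trans _ _ (\int[mu]_z h^\+ z)).
  apply: ae_ge0_le_integral => //; [exact: measurable_funepos|exact: measurable_funepos|].
  apply: filterS fh => z fh _; rewrite !funeposE.
  by rewrite ge_max !le_max fh/= lexx orbT.
by apply: integrable_lty => //; exact: integrable_funepos.
Qed.

(** Needed because [gap] contains [fine] of the conjugate; integrable functions are finite almost
    everywhere. *)
Lemma integrable_fine (f : Z -> \bar R) : mu.-integrable setT f ->
  mu.-integrable setT (fun z => (fine (f z))%:E) /\
  \int[mu]_z (fine (f z))%:E = \int[mu]_z f z.
Proof.
move=> fi; have [mf fo] := integrableP _ _ _ fi.
have mff : measurable_fun setT (fun z => (fine (f z))%:E).
  by apply/measurable_EFinP; apply: measurableT_comp mf; exact: fine_measurable.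
have ff : {ae mu, forall z, [set: Z] z -> (fine (f z))%:E = f z}.
  by apply: filterS (integrable_ae measurableT fi) => z /[swap] _ /(_ I) /fineK.
split; last exact: ae_eq_integral.
apply/integrableP; split => //; rewrite (ae_eq_integral (abse \o f))//.
- exact: measurableT_comp.
- exact: measurableT_comp.
- by apply: filterS ff => z h _; exact: (congr1 abse (h I)).
Qed.

End eintegral_theory.

Section inner_theory.
Context {R : realType} {d : nat}.
Implicit Types (u v w : 'rV[R]_d).

Lemma inner_conv (e : R) u v w :
  inner ((1 - e) *: u + e *: v) w = (1 - e) * inner u w + e * inner v w.
Proof.
rewrite /inner !mulr_sumr -big_split/=; apply: eq_bigr => i _.
by rewrite !mxE; ring.
Qed.

End inner_theory.

(** * The moment problem *)

Section moment_problem.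
Context {disp : measure_display} {Z : measurableType disp} {R : realType} {d : nat}.
Variable mu : {sigma_finite_measure set Z -> \bar R}.
Variable phi : Z -> 'rV[R]_d.
Variable beta : Z -> R -> \bar R.
Hypothesis hphi : measurable_moment_map phi.
Hypothesis hbeta : integrand_class beta.
Variable a : 'rV[R]_d.
Implicit Types (g : Z -> R) (theta eta : 'rV[R]_d).
Local Open Scope ereal_scope.

Local Notation r theta z := (inner theta (phi z)).
Local Notation betas theta := (fun z => conjugate (beta z) (inner theta (phi z))).
Local Notation J := (J_fun mu phi beta a).
Local Notation K := (K_fun mu phi beta).
Local Notation Theta := (Theta mu phi beta).
Local Notation dual_solution := (dual_solution mu phi beta a).
Local Notation minimizing_sequence := (minimizing_sequence mu phi beta a).

Let Gbeta z : Gamma (beta z). Proof. by case: hbeta. Qed.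

Lemma measurable_inner theta : measurable_fun setT (fun z => r theta z).
Proof.
apply: measurable_sum => i; apply: measurable_funM => //.
Qed.

Lemma measurable_conjugate_inner theta : measurable_fun setT (betas theta).
Proof. exact: measurable_conjugate (measurable_inner theta). Qed.

Lemma integral_inner theta g : calG_at mu phi a g ->
  mu.-integrable setT (fun z => (r theta z * g z)%:E) /\
  \int[mu]_z (r theta z * g z)%:E = (inner theta a)%:E.
Proof.
move=> [[mg gi] ga].
have -> : (fun z => (r theta z * g z)%:E) =
    (fun z => \sum_(i < d) (theta ord0 i)%:E * (phi z ord0 i * g z)%:E).
  apply/funext => z; rewrite /inner mulr_suml -sumEFin.
  by apply: eq_bigr => i _; rewrite -EFinM mulrA.
split.
  by apply: integrable_sum => // i _; apply: integrableZl.
rewrite integral_sum//; last by move=> i; apply: integrableZl.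
rewrite /inner -sumEFin; apply: eq_bigr => i _.
by rewrite integralZl// ga EFinM.
Qed.

(** * Dual solutions and the integrated Fenchel-Young gap *)

Lemma K_fin_dual theta : dual_solution theta -> K theta \is a fin_num.
Proof. by move=> [Dfin DE]; move: Dfin; rewrite -DE; case: (K theta). Qed.

Lemma K_lower theta eta : dual_solution theta ->
  (inner eta a)%:E - K eta <= (inner theta a)%:E - K theta.
Proof. by move=> [_ ->]; apply: ereal_sup_ubound; exists eta. Qed.

(** Finiteness of [H_fun] and [K] makes every term of the gap integrable, and the moment constraint
    evaluates the linear term. *)
Lemma gap_integral theta g : K theta \is a fin_num ->
  calG_at mu phi a g -> H_fun mu beta g \is a fin_num ->
  mu.-integrable setT (fun z => gap (beta z) (r theta z) (g z)) /\
  \int[mu]_z gap (beta z) (r theta z) (g z) =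
    H_fun mu beta g + K theta - (inner theta a)%:E.
Proof.
move=> Kfin ga Hfin.
have mg : measurable_fun setT g by case: ga => [[]].
have bi := eintegral_fin_num_integrable (measurable_integrand hbeta mg) Hfin.
have ci := eintegral_fin_num_integrable (measurable_conjugate_inner theta) Kfin.
have [fi fE] := integrable_fine ci.
have [ii iE] := integral_inner theta ga.
have -> : (fun z => gap (beta z) (r theta z) (g z)) =
    (fun z => beta z (g z) + ((fine (betas theta z))%:E - (r theta z * g z)%:E)).
  by apply/funext => z.
have fi2 := integrableB measurableT fi ii.
split; first exact: integrableD.
rewrite integralD// integralB// fE iE /H_fun /K_fun !eintegral_integrable//.
by rewrite addeA.
Qed.

Lemma measurable_gap theta g : measurable_fun setT g ->
  measurable_fun setT (fun z => gap (beta z) (r theta z) (g z)).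
Proof.
move=> mg; apply: emeasurable_funD; first exact: measurable_integrand.
apply/measurable_EFinP; apply: measurable_funB.
  by apply: measurableT_comp (measurable_conjugate_inner theta); exact: fine_measurable.
by apply: measurable_funM => //; exact: measurable_inner.
Qed.

Lemma K_fin_ae theta : K theta \is a fin_num ->
  {ae mu, forall z, betas theta z \is a fin_num}.
Proof.
move=> /(eintegral_fin_num_integrable (measurable_conjugate_inner theta)) ci.
by apply: filterS (integrable_ae measurableT ci) => z; apply.
Qed.

Lemma gap_ge0 theta z t : betas theta z \is a fin_num ->
  0 <= gap (beta z) (r theta z) t.
Proof. by move=> cfin; apply: conjugate0_ge0; exact: conjugate_gap0. Qed.

Lemma exists_minimizing : J \is a fin_num ->
  exists gs, minimizing_sequence gs.
Proof.
move=> Jfin.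
have S0 : [set H_fun mu beta g | g in calG_at_nneg mu phi a] != set0.
  apply/eqP => S0; move: Jfin; rewrite /J_fun S0 ereal_inf0.
  by [].
have [u uS uJ] := ereal_inf_seq S0.
have /choice[gs gsP] : forall n, exists g, calG_at_nneg mu phi a g /\ H_fun mu beta g = u n.
  by move=> n; have [g ? ?] := uS n; exists g.
exists gs; split => //; first by move=> n; have [] := gsP n.
by under eq_fun => n do rewrite (gsP n).2.
Qed.

(** * The constraint qualification passes to dual solutions *)

Lemma Theta_K_fin theta eta : dual_solution theta -> Theta eta -> K eta \is a fin_num.
Proof.
move=> dt [Koo _]; rewrite fin_real// Koo andbT.
have := K_lower eta dt; rewrite -(fineK (K_fin_dual dt)).
by case: (K eta) Koo.
Qed.

(** Fatou's lemma replaces differentiation under the integral: the scaled convexity defects [w n]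
    along the segment from [theta] to [eta] have bounded integrals, yet tend to [+oo] wherever
    [theta] meets an endpoint. *)
Lemma dual_solution_Theta theta eta : dual_solution theta -> Theta eta -> Theta theta.
Proof.
move=> dt Te; have [_ enear] := Te.
have Kfin := K_fin_dual dt; have Kefin := Theta_K_fin dt Te.
split; first by rewrite ltey_eq Kfin.
pose e n : R := n.+1%:R^-1%R.
pose th n := ((1 - e n) *: theta + e n *: eta)%R.
pose u n z := (1 - e n)%:E * betas theta z + (e n)%:E * betas eta z.
pose w n z := n.+1%:R%:E * (u n z - betas (th n) z).
have mf := measurable_conjugate_inner.
have fi := eintegral_fin_num_integrable (mf theta) Kfin.
have fei := eintegral_fin_num_integrable (mf eta) Kefin.
have ui n : mu.-integrable setT (u n).
  by apply: integrableD => //; exact: integrableZl.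
have fu n z : betas (th n) z <= u n z.
  rewrite /th inner_conv; apply: conjugate_convex => //.
  by rewrite invr_ge0 ler0n/= invf_le1// ler1n.
(* The value [-oo] would make [th n] beat the dual solution [theta]. *)
have KthNy n : -oo < K (th n).
  have := K_lower (th n) dt; rewrite -(fineK Kfin).
  move=> H; rewrite ltNye; apply/eqP => KE; by move: H; rewrite KE.
have fni n : mu.-integrable setT (betas (th n)).
  by apply: eintegral_ae_le_integrable (KthNy n) => //; apply: aeW => z; exact: fu.
have wi n : mu.-integrable setT (w n).
  by apply: integrableZl => //; apply: integrableB.
have KE : K theta = \int[mu]_z betas theta z by exact: eintegral_integrable.
have KeE : K eta = \int[mu]_z betas eta z by exact: eintegral_integrable.
have KnE n : K (th n) = \int[mu]_z betas (th n) z by exact: eintegral_integrable.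
(* Optimality of [theta] against [th n], divided by the step [e n], leaves this bound independent of
   [n]. *)
pose C := (fine (K eta) - fine (K theta) + inner theta a - inner eta a)%R.
have mw n : measurable_fun setT (w n) by have [] := integrableP _ _ _ (wi n).
have arith (ia ib k1 k2 k3 s : R) : ((1 - s) * ia + s * ib - k3 <= ia - k1 ->
    (1 - s) * k1 + s * k2 - k3 <= s * (k2 - k1 + ia - ib))%R by lra.
(* [w n] is nonnegative only where the conjugate at [th n] is finite; absolute values give the
   pointwise nonnegativity that Fatou's lemma asks for. *)
have intw n : \int[mu]_z `|w n z| <= C%:E.
  have -> : \int[mu]_z `|w n z| = \int[mu]_z w n z.
    apply: ae_eq_integral => //; first exact: measurableT_comp.
    apply: filterS (integrable_ae measurableT (fni n)) => z /(_ I) /= fz _.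
    rewrite gee0_abs//; apply: mule_ge0; first by rewrite lee_fin.
    by rewrite leeBrDr// add0e fu.
  rewrite /w integralZl//; last exact: integrableB.
  rewrite integralB// /u integralD//; try exact: integrableZl.
  rewrite !integralZl// -KE -KeE -KnE.
  have Kn_fin : K (th n) \is a fin_num by rewrite KnE; exact: integrable_fin_num.
  have := K_lower (th n) dt.
  rewrite /th inner_conv -/(th n) /C.
  rewrite -(fineK Kfin) -(fineK Kefin) -(fineK Kn_fin) /=.
  rewrite -!EFinM !lee_fin => H.
  have -> : n.+1%:R = (e n)^-1%R by rewrite /e invrK.
  have e0 : (0 < e n)%R by rewrite invr_gt0.
  by rewrite ler_pdivrMl//; exact: arith H.
have liminf_int : \int[mu]_z limn_einf (fun n => `|w n z|) < +oo.
  apply: le_lt_trans (ltry C).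
  have mabs n : measurable_fun setT (abse \o w n) by exact: measurableT_comp.
  apply: (le_trans (fatou mu measurableT mabs (fun n z _ => abse_ge0 (w n z)))).
  rewrite limn_einf_lim; apply: lime_le; first exact: is_cvg_einfs.
  apply: nearW => n; apply: le_trans (intw n).
  by apply: ereal_inf_lbound; exists n => /=.
have liminf_ge0 z : 0 <= limn_einf (fun n => `|w n z|).
  rewrite limn_einf_lim; apply: lime_ge; first exact: is_cvg_einfs.
  by apply: nearW => n; apply: le_ereal_inf_tmp => _ [k _ <-].
have liminf_i : mu.-integrable setT (fun z => limn_einf (fun n => `|w n z|)).
  apply/integrableP; split.
    apply: measurableT_comp => //; apply: measurable_fun_limn_esup => n.
    by do 2 apply: measurableT_comp => //.
  by under eq_integral do rewrite gee0_abs//.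
have liminf_fin := integrable_ae measurableT liminf_i.
have thfin := K_fin_ae Kfin.
have rl : {ae mu, forall z, betas theta z \is a fin_num /\
    limn_einf (fun n => `|w n z|) \is a fin_num}.
  by apply: filterS2 thfin liminf_fin => z h1 /(_ I) h2.
apply: filterS2 enear rl => z snear [rfin lfin].
apply: contrapT => nnear.
(* At an endpoint the defects diverge, against the almost everywhere finite lower limit. *)
have /cvg_limn_einf_sup[lE _] : `|w n z| @[n --> \oo] --> +oo.
  have := conjugate_quotient_dvg (Gbeta z) rfin snear nnear.
  move=> /cvgeyPge H; apply/cvgeyPge => A; apply: filterS (H A) => n An.
  by rewrite /w /u /th inner_conv; apply: le_trans An _; exact: lee_abs.
by move: lfin; rewrite lE.
Qed.

(** * Minimizing sequences when the duality gap is zero *)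

Hypothesis hgap : J_fun mu phi beta a = dual_value mu phi beta a.

Lemma minimizing_gap_cvg theta gs :
  dual_solution theta -> minimizing_sequence gs ->
  \int[mu]_z `|gap (beta z) (r theta z) (gs n z)| @[n --> \oo] --> 0.
Proof.
move=> dt [Jfin gsG HJ]; have Kfin := K_fin_dual dt.
have JE : J = (inner theta a)%:E - K theta by rewrite hgap; case: dt.
have [Hfin _] : (\forall n \near \oo, H_fun mu beta (gs n) \is a fin_num) /\
    fine \o (fun n => H_fun mu beta (gs n)) @ \oo --> fine J.
  by apply/fine_cvgP; rewrite fineK.
have HJ0 : H_fun mu beta (gs n) - J @[n --> \oo] --> 0.
  by rewrite -(subee Jfin); apply: cvgeB => //;
    [rewrite fin_num_adde_defl// fin_numN|exact: cvg_cst].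
(* The integrated gap equals [H_fun mu beta (gs n) - J] as soon as [H_fun mu beta (gs n)] is finite,
   hence eventually. *)
apply: cvg_trans HJ0; apply: near_eq_cvg; apply: filterS Hfin => n Hn.
have [gi gE] := gap_integral Kfin (gsG n).1 Hn.
rewrite JE fin_num_oppeB// addeA -(addeAC _ (K theta)) -gE.
apply: ae_eq_integral => //.
  by have [] := integrableP _ _ _ gi.
  by apply: measurableT_comp => //; have [] := integrableP _ _ _ gi.
by apply: filterS (K_fin_ae Kfin) => z cfin _; rewrite gee0_abs// gap_ge0.
Qed.

(* Stands in for [f_of phi beta theta], whose measurability is not clear off the
   almost sure event on which the two agree. *)
Definition f_lim theta (z : Z) : R :=
  fine (limn_esup (fun n => n.+1%:R%:E *
    (conjugate (beta z) (r theta z + n.+1%:R^-1)%R - betas theta z))).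

Lemma measurable_f_lim theta : measurable_fun setT (f_lim theta).
Proof.
apply: measurableT_comp; first exact: fine_measurable.
apply: measurable_fun_limn_esup => n; apply: emeasurable_funM => //.
apply: emeasurable_funB; last exact: measurable_conjugate_inner.
apply: measurable_conjugate => //; apply: measurable_funD => //.
exact: measurable_inner.
Qed.

(** Here the upper limit is a genuine limit: the derivative of the conjugate, which is also the zero
    of the gap. *)
Lemma f_limP theta z :
  (\forall s \near r theta z, conjugate (beta z) s \is a fin_num) ->
  gap (beta z) (r theta z) (f_lim theta z) = 0 /\
  f_lim theta z = f_of phi beta theta z.
Proof.
move=> near_fin; have [t t0] := conjugate_gap_argmin (Gbeta z) near_fin.
have [dif der] := derive_conjugate (Gbeta z) near_fin t0.
have /cvg_limn_einf_sup[_ lE] := cvg_conjugate_seq (Gbeta z) near_fin t0.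
have -> : f_lim theta z = t by rewrite /f_lim lE.
by split => //; rewrite /f_of; case: asboolP.
Qed.

Lemma f_lim_ae theta : Theta theta -> f_lim theta = f_of phi beta theta %[ae mu].
Proof. by move=> [_]; apply: filterS => z /f_limP[]. Qed.

(** Being convex with a single zero, the gap at distance over [e] from [f_lim] is at least its
    smaller value at the two points at distance [e], a positive threshold depending on [z] alone. *)
Lemma minimizing_cvg theta gs : dual_solution theta -> Theta theta ->
  minimizing_sequence gs -> cvg_locally_in_measure mu gs (f_lim theta).
Proof.
move=> dt [_ Tt] ms Y e mY Yoo e0.
have mgs n : measurable_fun setT (gs n) by have [_ /(_ n)[[[]]]] := ms.
have mf := measurable_f_lim theta.
pose G z := gap (beta z) (r theta z).
(* The cap [1] keeps [m z] finite, since the gap is [+oo] at negative arguments. *)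
pose m z := mine 1 (mine (G z (f_lim theta z + e)%R) (G z (f_lim theta z - e)%R)).
apply: (measure_cvg0_of_integral (m := m) mY Yoo _ _ (minimizing_gap_cvg dt ms)).
- apply: measurable_mine => //; apply: measurable_mine; apply: measurable_gap => //.
  + exact: measurable_funD.
  + exact: measurable_funB.
- by move=> n; exact: measurable_gap.
- by move=> n; apply: measurableI => //; exact: measurable_dist_gt.
- by move=> n z [].
- apply: filterS Tt => z nz _; have [G0 _] := f_limP nz.
  have zfin := nbhs_singleton nz.
  have [p1 p2] := Gamma_argmin_sep (gap_Gamma _ (Gbeta z)) (fun t => gap_ge0 t zfin) G0 e0.
  by rewrite /m !lt_min p1 p2 lte01.
- move=> n; apply: filterS Tt => z nz [_ /= ez]; have [G0 _] := f_limP nz.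
  have zfin := nbhs_singleton nz.
  have G_ge0 := fun t => gap_ge0 t zfin.
  have m_ge0 : 0 <= m z by rewrite /m !le_min lee01 !G_ge0.
  have mfin : m z \is a fin_num.
    by rewrite ge0_fin_numE// (@le_lt_trans _ _ 1) ?ltry// ge_min lexx.
  rewrite gee0_abs//.
  have m1 : (fine (m z))%:E <= G z (f_lim theta z + e)%R.
    by rewrite fineK// /m !ge_min lexx orbT.
  have m2 : (fine (m z))%:E <= G z (f_lim theta z - e)%R.
    by rewrite fineK// /m !ge_min lexx !orbT.
  have := Gamma_linear_growth (gap_Gamma _ (Gbeta z)) G_ge0 G0 e0 m1 m2 (ltW ez).
  apply: le_trans; rewrite -{1}(fineK mfin) lee_fin -mulrA ler_peMr ?fine_ge0//.
  by rewrite ler_pdivlMl// mulr1 ltW.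
Qed.

(** At an endpoint the gap is positive and nonincreasing, so [gs n z <= M] costs at least the gap at
    [M]. Vanishing integrals then drive [gs n] above every [M] on [A]. *)
Lemma limit_Theta theta gs g : dual_solution theta -> minimizing_sequence gs ->
  measurable_fun setT g -> cvg_locally_in_measure mu gs g -> Theta theta.
Proof.
move=> dt ms mg cg; have Kfin := K_fin_dual dt.
have mgs n : measurable_fun setT (gs n) by have [_ /(_ n)[[[]]]] := ms.
(* A countable description of the points near which the conjugate is not finite; it makes this set
   measurable. *)
pose A := \bigcap_(n : nat) [set z | +oo <= conjugate (beta z) (r theta z + n.+1%:R^-1)%R].
have mA : measurable A.
  apply: bigcapT_measurable => n; rewrite -[X in measurable X]setTI.
  apply: emeasurable_fun_c_infty => //.
  apply: measurable_conjugate => //; apply: measurable_funD => //.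
  exact: measurable_inner.
have AE z : A z <-> ~ (\forall s \near r theta z, conjugate (beta z) s \is a fin_num).
  split; first by move=> Az /(near_conjugate_fin_num _ (Gbeta z))[n]; rewrite ltNge Az.
  move=> nz n _ /=; rewrite leNgt; apply/negP => nfin; apply: nz.
  by apply/(near_conjugate_fin_num _ (Gbeta z)); exists n.
suff A0 : mu A = 0.
  split; first by rewrite ltey_eq Kfin.
  exists A; split => // z; exact: (AE z).2.
apply: (measure0_of_escape mA mgs mg cg) => Y M mY YA Yoo M0.
have zfin_ae := K_fin_ae Kfin.
have endpoint z : betas theta z \is a fin_num -> A z ->
    0 < gap (beta z) (r theta z) M /\
    forall t, (t <= M)%R -> gap (beta z) (r theta z) M <= gap (beta z) (r theta z) t.
  move=> zfin /AE nz; apply: Gamma_endpoint => //; first exact: gap_Gamma.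
    by move=> t; exact: gap_ge0.
  by move=> c c0; rewrite conjugate_gap// (not_near_conjugate (Gbeta z) nz c0) -(fineK zfin).
apply: (measure_cvg0_of_integral (m := fun z => gap (beta z) (r theta z) M) mY Yoo _ _
   (minimizing_gap_cvg dt ms)).
- exact: measurable_gap.
- by move=> n; exact: measurable_gap.
- move=> n; apply: measurableI => //; rewrite -[X in measurable X]setTI.
  have -> : [set z | (gs n z <= M)%R] = gs n @^-1` `]-oo, M]%classic.
    by apply/seteqP; split => z /=; rewrite in_itv/=.
  by apply: mgs.
- by move=> n z [].
- by apply: filterS zfin_ae => z zfin Yz; have [] := endpoint _ zfin (YA _ Yz).
- move=> n; apply: filterS zfin_ae => z zfin [Yz /= gM].
  rewrite gee0_abs; last exact: gap_ge0.
  by have [_ ->] := endpoint _ zfin (YA _ Yz).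
Qed.

End moment_problem.

Theorem theorem4p17 (disp : measure_display) (Z : measurableType disp)
    (R : realType) (d : nat) (mu : {sigma_finite_measure set Z -> \bar R})
    (phi : Z -> 'rV[R]_d) (beta : Z -> R -> \bar R) (a : 'rV[R]_d)
    (hphi : measurable_moment_map phi)
    (hbeta : integrand_class beta)
    (hgap : J_fun mu phi beta a = dual_value mu phi beta a)
    (hattained : exists theta, dual_solution mu phi beta a theta) :
  ((exists ghat, generalized_primal_solution mu phi beta a ghat) <->
     Theta mu phi beta !=set0) /\
  (Theta mu phi beta !=set0 ->
     (exists gstar, effective_dual_solution mu phi beta a gstar) /\
     (forall ghat gstar,
        generalized_primal_solution mu phi beta a ghat ->
        effective_dual_solution mu phi beta a gstar ->
        ghat = gstar %[ae mu])).
Proof.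
have [theta dt] := hattained.
have Jfin : J_fun mu phi beta a \is a fin_num by rewrite hgap; case: dt.
have [gs ms] := exists_minimizing Jfin.
have mgs n : measurable_fun setT (gs n) by have [_ /(_ n)[[[]]]] := ms.
have mf := measurable_f_lim hphi hbeta.
split; first split.
- move=> [ghat [_ mg cg]]; exists theta.
  exact: (limit_Theta hphi hbeta hgap dt ms mg (cg _ ms)).
(* The candidate limit comes from the dual solution [theta], not from [eta], which serves only to
   place [theta] in [Theta]. *)
- move=> [eta Te]; exists (f_lim phi beta theta); split => // hs hms.
  exact: (minimizing_cvg hphi hbeta hgap dt (dual_solution_Theta hphi hbeta dt Te)).
move=> [eta Te].
have dual_Theta th (dth : dual_solution mu phi beta a th) : Theta mu phi beta th.
  exact: (dual_solution_Theta hphi hbeta dth Te).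
have cv th (dth : dual_solution mu phi beta a th) :
    cvg_locally_in_measure mu gs (f_lim phi beta th).
  exact: (minimizing_cvg hphi hbeta hgap dth (dual_Theta _ dth) ms).
split.
  exists (f_of phi beta theta); split; first by exists theta.
  move=> th dth; split; first exact: dual_Theta.
  have e1 := f_lim_ae hbeta (dual_Theta _ dt).
  have e2 := f_lim_ae hbeta (dual_Theta _ dth).
  (* Two dual solutions give the same function because both functions are limits of the one
     minimizing sequence [gs]. *)
  have e3 := cvg_locally_in_measure_unique mgs (mf theta) (mf th) (cv _ dt) (cv _ dth).
  exact: ae_eq_trans (ae_eq_sym e1) (ae_eq_trans e3 e2).
move=> ghat gstar [_ mg cg] [_ /(_ _ dt)[_ ge]].
have e1 := f_lim_ae hbeta (dual_Theta _ dt).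
have e3 := cvg_locally_in_measure_unique mgs mg (mf theta) (cg _ ms) (cv _ dt).
exact: ae_eq_trans e3 (ae_eq_trans e1 (ae_eq_sym ge)).
Qed.
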